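(* Let $\mathcal{A}$ be an $n$-dimensional arrangement of $m$ hyperplanes of rank $r=r(\mathcal{A})$, and write its characteristic polynomial as \[ \chi(\mathcal{A};t)=a_0t^n-a_1t^{n-1}+a_2t^{n-2}+\cdots+(-1)^ra_rt^{n-r}, \] with the convention $a_i=0$ for $i>r$. If $q,k\in\mathbb{Z}$ satisfy $0\le k\le q+r+1$, then \[ \binom{r+q}{k}\le \sum_{i=0}^{k}\binom{q}{k-i}a_{i}\le \binom{m+q}{k}. \]
   Context: An $n$-dimensional hyperplane arrangement $\mathcal{A}$ is a finite set of (affine, not necessarily through the origin) hyperplanes in an $n$-dimensional vector space $V$. The intersection semi-lattice $L(\mathcal{A})$ is the set of all nonempty intersections $\bigcap_{H\in\mathcal{B}}H$ with $\mathcal{B}\subseteq\mathcal{A}$, including $V=\bigcap_{H\in\emptyset}H$, partially ordered by reverse inclusion; its minimal element is $\hat 0=V$. The rank $r(\mathcal{A})$ is the maximal rank of $L(\mathcal{A})$, equivalently the dimension of the span of the normal vectors of the hyperplanes in $\mathcal{A}$. The characteristic polynomial is $\chi(\mathcal{A};t)=\sum_{X\in L(\mathcal{A})}\mu(\hat 0,X)\,t^{\dim X}$, where $\mu$ is the Möbius function of $L(\mathcal{A})$. For $\alpha\in\mathbb{C}$ and $k\in\mathbb{Z}_{\ge0}$, $\binom{\alpha}{k}=\frac{1}{k!}\alpha(\alpha-1)\cdots(\alpha-k+1)$ is the generalized binomial coefficient (so $\binom{\alpha}{0}=1$). *)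

(* Defs.v *)
From HB Require Import structures.
From mathcomp Require Import all_boot all_order all_algebra finmap.
From mathcomp Require Import boolp classical_sets.

Set Implicit Arguments.
Unset Strict Implicit.
Unset Printing Implicit Defensive.

Import Order.TTheory GRing.Theory Num.Theory.

Local Open Scope ring_scope.
Local Open Scope classical_set_scope.

Section FinitePosets.
Context {d : Order.disp_t} {P : finPOrderType d}.
Implicit Types x y z : P.

(* The number of recursive calls is bounded by the length of a chain, hence by
   #|P|; mobiusE below is the usual recursion, without fuel. *)
Fixpoint mobius_rec (k : nat) (x y : P) : int :=
  if k is k'.+1 then
    if x == y then 1
    else - \sum_(z : P | (x <= z)%O && (z < y)%O) mobius_rec k' x z
  else 0.

Definition mobius (x y : P) : int := mobius_rec #|P| x y.

Lemma mobius_rec_stable k1 k2 x y :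
  (#|[set z | (z <= y)%O]%SET| <= k1)%N ->
  (#|[set z | (z <= y)%O]%SET| <= k2)%N ->
  mobius_rec k1 x y = mobius_rec k2 x y.
Proof.
have gt0 (t : P) : (0 < #|[set z | (z <= t)%O]%SET|)%N.
  by apply/card_gt0P; exists t; rewrite inE.
elim: k1 k2 y => [|k1 IH] [|k2] y h1 h2 //=.
- by have := gt0 y; rewrite ltnNge h1.
- by have := gt0 y; rewrite ltnNge h2.
case: eqP => // _; congr (- _); apply: eq_bigr => z /andP[_ zy].
have lt : (#|[set t | (t <= z)%O]%SET| < #|[set t | (t <= y)%O]%SET|)%N.
  apply: proper_card; apply/properP; split.
    by apply/fintype.subsetP => t; rewrite !inE => /le_trans; apply; apply: ltW.
  by exists y; rewrite !inE // lt_geF.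
by apply: IH; rewrite -ltnS; apply: leq_trans lt _.
Qed.

Lemma mobiusE x y :
  mobius x y =
  if x == y then 1 else - \sum_(z : P | (x <= z)%O && (z < y)%O) mobius x z.
Proof.
rewrite /mobius -(@mobius_rec_stable #|P|.+1) ?max_card //.
by rewrite (leq_trans (max_card _)).
Qed.

Definition is_chain (C : {set P}) : bool :=
  [forall x in C, forall y in C, (x >=< y)%O].

(* A chain with c elements has length c - 1. *)
Definition poset_rank (x : P) : nat :=
  \max_(C : {set P} | is_chain C && [forall y in C, (y <= x)%O]) #|C|.-1.

End FinitePosets.

Section Arrangements.
Context {F : fieldType} {V : vectType F}.

Definition is_hyperplane (H : set V) : Prop :=
  exists (f : 'Hom(V, F^o)) (c : F), f != 0 /\ H = [set x | f x = c].

Definition is_arrangement (A : {fset set V}) : Prop :=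
  forall H : set V, H \in A -> is_hyperplane H.

Definition is_direction (X : set V) (W : {vspace V}) : Prop :=
  exists x : V, X = [set x + w | w in [set w : V | w \in W]].

(* Dimension of the direction space of an affine subspace; it is 0 on sets
   that are not affine subspaces, which do not occur as flats. *)
Definition affine_dim (X : set V) : nat :=
  \dim (xget 0%VS [set W : {vspace V} | is_direction X W]).

Definition flat_of (B : {fset set V}) : set V :=
  \bigcap_(H in [set H : set V | H \in B]) H.

Definition flats (A : {fset set V}) : {fset set V} :=
  [fset X in [fset flat_of B | B in fpowerset A] | X != set0]%fset.

Definition semilattice (A : {fset set V}) : Type := fset_sub_type (flats A).

HB.instance Definition _ A := Finite.on (semilattice A).

(* Reverse inclusion. *)
Definition flat_le A (X Y : semilattice A) : bool := `[< val Y `<=` val X >].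

Fact flat_le_refl A : reflexive (@flat_le A).
Proof. by move=> X; apply/asboolP. Qed.

Fact flat_le_anti A : antisymmetric (@flat_le A).
Proof.
move=> X Y /andP[/asboolP YX /asboolP XY].
by apply: val_inj; apply/seteqP.
Qed.

Fact flat_le_trans A : transitive (@flat_le A).
Proof.
move=> Y X Z /asboolP YX /asboolP ZY.
by apply/asboolP => v /ZY /YX.
Qed.

Fact flat_display : Order.disp_t. Proof. by []. Qed.

HB.instance Definition _ A :=
  Order.Le_isPOrder.Build flat_display (semilattice A)
    (@flat_le_refl A) (@flat_le_anti A) (@flat_le_trans A).

Fact setT_flat A : setT \in flats A.
Proof.
rewrite !inE /=; apply/andP; split.
  apply/imfsetP; exists fset0; first by rewrite /= fpowersetE fsub0set.
  by apply/seteqP; split => // v _ H /=; rewrite inE.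
by apply/eqP => /seteqP[/(_ 0 I)].
Qed.

Definition flat0 A : semilattice A := FSetSub (setT_flat A).

Definition arr_rank A : nat := \max_(X : semilattice A) poset_rank X.

Definition char_poly_arr A : {poly int} :=
  \sum_(X : semilattice A) mobius (flat0 A) X *: 'X^(affine_dim (val X)).

(* The a_i of chi(A; t) = a_0 t^n - a_1 t^(n-1) + ... + (-1)^r a_r t^(n-r). *)
Definition char_coef A (i : nat) : int :=
  if (i <= arr_rank A)%N then
    (-1) ^+ i * (char_poly_arr A)`_(\dim {:V} - i)
  else 0.

End Arrangements.

Definition gbinom {R : numFieldType} (alpha : R) (k : nat) : R :=
  (\prod_(i < k) (alpha - i%:R)) / (k`!)%:R.

(* Main.v *)
(* Whitney's theorem turns chi(A; t) into the signed sum, over the central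
   subarrangements B of A, of t^(dim of the intersection of B).  Generalizing
   from V to an affine subspace X, this sum obeys the deletion-restriction
   recursion Q(X, H :: s) = Q(X, s) - Q(X `&` H, s), even when s restricted to
   X `&` H has repeated hyperplanes.  With a(x) = sum_i a_i x^i, the middle
   term of the theorem is the coefficient of x^k in (1 + x)^q a(x), and the
   bounds follow by induction on s:
   - if the normal of H is independent of the other ones, then
     a(x) = (1 + x) a'(x), and the bounds for a' with q + 1 are those for a
     with q;
   - otherwise, if X `&` H is empty or lies in another hyperplane of s, the
     restriction contributes 0 and a = a';
   - otherwise a(x) = a'(x) + x a''(x) with ranks r and r - 1, and Pascal's
     rule applies. *)
Require Import Defs.
From HB Require Import structures.
From mathcomp Require Import all_boot all_order all_algebra finmap.
From mathcomp Require Import boolp classical_sets.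
From mathcomp Require Import ring zify.

Set Implicit Arguments.
Unset Strict Implicit.
Unset Printing Implicit Defensive.

Import Order.TTheory GRing.Theory Num.Theory.

Local Open Scope ring_scope.
Local Open Scope classical_set_scope.

(** * Generalized binomial coefficients and convolution with them *)

Section GeneralizedBinomial.
Implicit Types (q N : int) (k : nat) (p : {poly int}).

Lemma gbinom0 (R : numFieldType) (x : R) : gbinom x 0 = 1.
Proof. by rewrite /gbinom big_ord0 fact0 divr1. Qed.

(** Pascal's rule: over the common factor [\prod_(i < k) (x - i)], it reduces to x + 1 = (x - k) +
    (k + 1). *)
Lemma gbinomSS (R : numFieldType) (x : R) k :
  gbinom (x + 1) k.+1 = gbinom x k.+1 + gbinom x k.
Proof.
rewrite /gbinom big_ord_recl big_ord_recr /= factS natrM.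
under eq_bigr => i _.
  have -> : x + 1 - (lift ord0 i)%:R = x - i%:R :> R.
    by rewrite lift0 -addn1 natrD; ring.
over.
have k0 : (k`!)%:R != 0 :> R by rewrite pnatr_eq0 -lt0n fact_gt0.
have k1 : k.+1%:R != 0 :> R by rewrite pnatr_eq0.
move: k1; rewrite -addn1 natrD => k1.
by field; rewrite k0 /= addrC; move: k1; rewrite addrC.
Qed.

(** Every factor N - i with i < k is nonnegative. In the extreme case k = N + 1 > 0 the last factor
    is zero, which is why the range of the theorem reaches q + r + 1. *)
Lemma gbinom_ge0 N k : k%:Z <= N + 1 -> 0 <= gbinom (N%:~R : rat) k.
Proof.
move=> kN; apply: divr_ge0; last exact: ler0n.
apply: prodr_ge0 => i _; rewrite pmulrn -intrB ler0z.
by have := ltn_ord i; lia.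
Qed.

Lemma gbinom_leS N k : k%:Z <= N + 1 ->
  gbinom (N%:~R : rat) k <= gbinom (N + 1)%:~R k.
Proof.
case: k => [|k] kN; first by rewrite !gbinom0.
by rewrite intrD gbinomSS lerDl gbinom_ge0 //; lia.
Qed.

(** The coefficient of x^k in (1 + x)^q p(x), for q of either sign. *)
Definition binom_conv p q k : rat :=
  \sum_(i < k.+1) gbinom q%:~R (k - i) * (p`_i)%:~R.

Lemma binom_conv1 q k : binom_conv 1 q k = gbinom q%:~R k.
Proof.
rewrite /binom_conv big_ord_recl big1 /=; last first.
  by move=> i _; rewrite coef1 mulr0.
by rewrite coef1 subn0 /= mulr1 addr0.
Qed.

Lemma binom_convD p1 p2 q k :
  binom_conv (p1 + p2) q k = binom_conv p1 q k + binom_conv p2 q k.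
Proof.
rewrite /binom_conv -big_split; apply: eq_bigr => i _ /=.
by rewrite coefD intrD mulrDr.
Qed.

Lemma binom_convX0 p q : binom_conv ('X * p) q 0 = 0.
Proof. by rewrite /binom_conv big_ord1 coefXM /= mulr0. Qed.

Lemma binom_convXS p q k : binom_conv ('X * p) q k.+1 = binom_conv p q k.
Proof.
rewrite /binom_conv big_ord_recl coefXM /= mulr0 add0r.
by apply: eq_bigr => i _; rewrite coefXM.
Qed.

(** A factor 1 + x can be moved from p into the power (1 + x)^q, by Pascal's rule term by term. *)
Lemma binom_conv_shift p q k :
  binom_conv (p + 'X * p) q k = binom_conv p (q + 1) k.
Proof.
rewrite binom_convD; case: k => [|k].
  by rewrite binom_convX0 addr0 /binom_conv !big_ord1 !gbinom0.
(* The term of index k + 1 carries a binomial coefficient with lower entry 0, where Pascal's rule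
   does not apply; it is the same on both sides. *)
rewrite binom_convXS /binom_conv [in LHS]big_ord_recr [in RHS]big_ord_recr /=.
rewrite subnn !gbinom0 addrAC -big_split /=; congr (_ + _).
apply: eq_bigr => i _ /=.
have ik : (i <= k)%N by rewrite -ltnS.
by rewrite subSn // intrD gbinomSS mulrDl.
Qed.

End GeneralizedBinomial.

(** * Signed sums over sublists of a list of sets *)

Section WhitneySum.
Context {T : Type} {M : zmodType}.
Implicit Types (phi : set T -> M) (X Y H : set T) (s : seq (set T)).

(* The sum of (-1)^|B| phi (X `&` \bigcap B) over the sublists B of s. *)
Fixpoint whitney phi X s : M :=
  if s is H :: s' then whitney phi X s' - whitney phi (X `&` H) s' else phi X.

(** Only intersections of [X] with members of [s] are ever evaluated, so agreement on a class closed
    under these is enough; below, the class is [is_intersection]. *)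
Lemma eq_whitney (P : set T -> Prop) phi1 phi2 X s :
  (forall Y H, P Y -> H \in s -> P (Y `&` H)) ->
  (forall Y, P Y -> phi1 Y = phi2 Y) -> P X ->
  whitney phi1 X s = whitney phi2 X s.
Proof.
move=> + e12; elim: s X => [|H s IH] X /= clP PX; first exact: e12.
have clPs Y G : P Y -> G \in s -> P (Y `&` G).
  by move=> PY Gs; apply: clP; rewrite // inE Gs orbT.
by rewrite !IH //; apply: clP; rewrite // mem_head.
Qed.

(** Sublists with and without a given occurrence of [H] have opposite signs and equal values, so
    they cancel in pairs. *)
Lemma whitney_eq0 phi X s H : H \in s ->
  (forall Y, Y `<=` X -> phi (Y `&` H) = phi Y) -> whitney phi X s = 0.
Proof.
move=> Hs eH.
have main : forall s X Y, Y `<=` X ->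
    (forall Y, Y `<=` X -> phi (Y `&` H) = phi Y) ->
    whitney phi (Y `&` H) s = whitney phi Y s.
  elim=> [|G s' IH] X' Y YX' e /=; first exact: e.
  rewrite (IH X') // setIAC (IH X') //.
  by apply: subset_trans YX'; apply: subIsetl.
elim: s X Hs eH => [//|G s IH] X; rewrite inE => /orP[/eqP <-|Hs] eH /=.
  by rewrite (main s X X) // subrr.
rewrite !IH ?subrr // => Y YX; apply: eH.
by apply: subset_trans YX _; apply: subIsetl.
Qed.

(** Only the empty sublist contributes. *)
Lemma whitney_id phi X s :
  (forall Y H, H \in s -> phi (Y `&` H) = 0) -> whitney phi X s = phi X.
Proof.
elim: s X => //= H s IH X e0.
have e0' Y G : G \in s -> phi (Y `&` G) = 0.
  by move=> Gs; apply: e0; rewrite inE Gs orbT.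
by rewrite !IH // e0 ?mem_head // subr0.
Qed.

Lemma whitney_sum (I : Type) (r : seq I) (P : pred I)
    (f : I -> set T -> M) X s :
  \sum_(i <- r | P i) whitney (f i) X s =
  whitney (fun Y => \sum_(i <- r | P i) f i Y) X s.
Proof. by elim: s X => //= H s IH X; rewrite sumrB !IH. Qed.

End WhitneySum.

Lemma whitney_scale (T : Type) (R : pzRingType) (M : lmodType R) (v : M)
    (phi : set T -> R) X s :
  whitney phi X s *: v = whitney (fun Y => phi Y *: v) X s.
Proof. by elim: s X => //= H s IH X; rewrite scalerBl !IH. Qed.

(** * Passing between a(x) and the characteristic polynomial *)

Section ReverseAlternating.
Implicit Types (p : {poly int}) (d : nat).

(** This is t^d p(-1/t), with the coefficients of [p] beyond degree [d] dropped. *)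
Definition rev_alt p d : {poly int} :=
  \sum_(i < d.+1) ((-1) ^+ i * p`_i) *: 'X^(d - i).

Lemma rev_alt1 d : rev_alt 1 d = 'X^d.
Proof.
rewrite /rev_alt big_ord_recl big1 => [|i _].
  by rewrite coef1 expr0 mul1r scale1r subn0 addr0.
by rewrite coef1 mulr0 scale0r.
Qed.

Lemma rev_altD p1 p2 d : rev_alt (p1 + p2) d = rev_alt p1 d + rev_alt p2 d.
Proof.
rewrite /rev_alt -big_split; apply: eq_bigr => i _ /=.
by rewrite coefD mulrDr scalerDl.
Qed.

Lemma rev_altX p d : rev_alt ('X * p) d.+1 = - rev_alt p d.
Proof.
rewrite /rev_alt big_ord_recl coefXM mulr0 scale0r add0r -sumrN.
apply: eq_bigr => i _.
by rewrite coefXM lift0 /= subSS exprS !mulN1r mulNr scaleNr.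
Qed.

Lemma rev_altS p d : (size p <= d.+1)%N -> rev_alt p d.+1 = 'X * rev_alt p d.
Proof.
move=> pd; rewrite /rev_alt big_ord_recr /= nth_default // mulr0 scale0r addr0.
rewrite mulr_sumr; apply: eq_bigr => i _.
have id : (i <= d)%N by rewrite -ltnS.
by rewrite subSn // exprS scalerAr.
Qed.

Lemma rev_alt_trunc p r d : (r <= d)%N -> (size p <= r.+1)%N ->
  rev_alt p d = \sum_(i < r.+1) ((-1) ^+ i * p`_i) *: 'X^(d - i).
Proof.
move=> rd pr; pose g i : {poly int} := ((-1) ^+ i * p`_i) *: 'X^(d - i).
rewrite /rev_alt -!(big_mkord xpredT g) (big_cat_nat (n := r.+1)) //=.
rewrite [X in _ + X]big1_seq ?addr0 // => i /andP[_].
rewrite mem_index_iota => /andP[ri _].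
by rewrite /g nth_default ?(leq_trans pr) // mulr0 scale0r.
Qed.

Lemma coef_rev_alt p i d : (i <= d)%N ->
  (-1) ^+ i * (rev_alt p d)`_(d - i) = p`_i.
Proof.
move=> id; have id' : (i < d.+1)%N by [].
rewrite /rev_alt coef_sum (bigD1 (Ordinal id')) //= big1 => [|j ji].
  rewrite coefZ coefXn eqxx mulr1 addr0 mulrA.
  by rewrite -exprMn mulrNN mulr1 expr1n mul1r.
rewrite coefZ coefXn; case: eqP => [e|_]; last by rewrite mulr0.
case/eqP: ji; apply: val_inj => /=.
by have := ltn_ord j; move: e id; lia.
Qed.

End ReverseAlternating.

(** * Affine subspaces, relative rank, and the bounds for Whitney sums *)

Section AffineGeometry.
Context {F : fieldType} {V : vectType F}.
Implicit Types (X Y : set V) (U W : {vspace V}) (h : 'Hom(V, F^o) * F).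
Implicit Types (s : seq ('Hom(V, F^o) * F)) (x y w : V).

Lemma is_directionP X W x :
  is_direction X W -> X x -> forall y, X y <-> y - x \in W.
Proof.
move=> [x0 ->] [w /= wW <-] y; split.
  move=> [w' /= w'W <-].
  by rewrite opprD addrACA subrr add0r rpredB.
move=> yW; exists (y - x0); last by rewrite addrC subrK.
by rewrite /= -[y - x0](subrK w) -[_ - _ - w]addrA -opprD rpredD.
Qed.

Lemma is_directionI X W x :
  (forall y, X y <-> y - x \in W) -> is_direction X W.
Proof.
move=> XW; exists x; apply/seteqP; split => y.
  by move=> /XW yW; exists (y - x) => //; rewrite addrC subrK.
by move=> [w /= wW <-]; apply/XW; rewrite addrC addKr.
Qed.

Lemma is_direction_nonempty X W : is_direction X W -> exists x, X x.
Proof. by move=> [x ->]; exists (x + 0), 0 => //=; rewrite mem0v. Qed.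

Lemma is_direction_sub X Y W U :
  is_direction X W -> is_direction Y U -> Y `<=` X -> (U <= W)%VS.
Proof.
move=> dX dY YX; have [y Yy] := is_direction_nonempty dY.
apply/subvP => u uU; rewrite -[u](addKr y) addrC.
apply/(is_directionP dX (YX _ Yy)); apply: YX.
by apply/(is_directionP dY Yy); rewrite addrAC subrr add0r.
Qed.

(** Two directions of the same set contain each other, so the choice made by [xget] is
    immaterial. *)
Lemma affine_dimE X W : is_direction X W -> affine_dim X = \dim W.
Proof.
move=> dX; rewrite /affine_dim.
have dX' : is_direction X (xget 0%VS [set W' : {vspace V} | is_direction X W']).
  by case: xgetP => [U -> //|/(_ W)].
by apply/anti_leq; rewrite !dimvS //
  (is_direction_sub dX dX', is_direction_sub dX' dX).
Qed.

Lemma is_directionT : is_direction [set: V] fullv.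
Proof. by apply: (@is_directionI _ _ 0) => y; rewrite memvf. Qed.

Lemma affine_dim_lt X Y W U : is_direction X W -> is_direction Y U ->
  Y `<=` X -> X <> Y -> (affine_dim Y < affine_dim X)%N.
Proof.
move=> dX dY YX neq; rewrite (affine_dimE dX) (affine_dimE dY).
have UW := is_direction_sub dX dY YX.
rewrite ltn_neqAle dimvS // andbT; apply/eqP => e; apply: neq.
have {e UW} eUW : U = W by apply/eqP; rewrite -dimv_leqif_eq // e.
have [y Yy] := is_direction_nonempty dY.
apply/seteqP; split => // x /(is_directionP dX (YX _ Yy)).
by rewrite -eUW => /(is_directionP dY Yy).
Qed.

(** Equations are kept instead of sets, since ranks are computed from the linear parts. *)
Definition hyperplane h : set V := [set x | h.1 x = h.2].

Definition common_ker s : {vspace V} := (\bigcap_(h <- s) lker h.1)%VS.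

Lemma common_ker_cons h s :
  common_ker (h :: s) = (lker h.1 :&: common_ker s)%VS.
Proof. by rewrite /common_ker big_cons. Qed.

Lemma hyperplane_meets X W h w : is_direction X W -> w \in W ->
  h.1 w != 0 -> exists2 x, X x & hyperplane h x.
Proof.
move=> dX wW hw; have [x Xx] := is_direction_nonempty dX.
exists (x + ((h.2 - h.1 x) / h.1 w) *: w).
  by apply/(is_directionP dX Xx); rewrite addrAC subrr add0r rpredZ.
rewrite /hyperplane /= linearD linearZ /=.
by rewrite /GRing.scale /= divfK // addrC subrK.
Qed.

Lemma is_direction_capI X W h x : is_direction X W -> X x -> hyperplane h x ->
  is_direction (X `&` hyperplane h) (W :&: lker h.1).
Proof.
move=> dX Xx hx; apply: (@is_directionI _ _ x) => y.
rewrite memv_cap memv_ker linearB /= hx subr_eq0; split.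
  by move=> [/(is_directionP dX Xx) -> /= ->]; rewrite eqxx.
by move=> /andP[/(is_directionP dX Xx) ? /eqP].
Qed.

(** Rank-nullity for [f] on [W]: the image lies in a line, so its dimension is 0 or 1. *)
Lemma dim_cap_lker W (f : 'Hom(V, F^o)) :
  (\dim (W :&: lker f) + ~~ (W <= lker f)%VS)%N = \dim W.
Proof.
rewrite -[RHS](limg_ker_dim f); congr addn.
rewrite lkerE; have : (\dim (f @: W) <= 1)%N.
  by apply: leq_trans (dimvS (subvf _)) _; rewrite dimvf.
by rewrite -dimv_eq0; case: (\dim _) => [|[]].
Qed.

Lemma memv_bigcap_lker s (P : pred ('Hom(V, F^o) * F)) x :
  x \in (\bigcap_(h <- s | P h) lker h.1)%VS <->
  (forall h, h \in s -> P h -> h.1 x = 0).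
Proof.
elim: s => [|h s IH]; first by rewrite big_nil memvf.
rewrite big_cons; case: ifPn => Ph.
  rewrite memv_cap memv_ker; split.
    move=> /andP[/eqP hx /IH sx] g; rewrite inE => /orP[/eqP -> //|].
    exact: sx.
  move=> hsx; rewrite hsx ?mem_head // eqxx; apply/IH => g gs.
  by apply: hsx; rewrite inE gs orbT.
split=> [/IH sx g|hsx].
  by rewrite inE => /orP[/eqP ->|/sx //]; rewrite (negPf Ph).
by apply/IH => g gs; apply: hsx; rewrite inE gs orbT.
Qed.

(** The dimension of the span of the linear parts of [s] restricted to [W]. *)
Definition rel_rank W s : nat := (\dim W - \dim (W :&: common_ker s))%N.

Lemma rel_rankE W s :
  (rel_rank W s + \dim (W :&: common_ker s))%N = \dim W.
Proof. by rewrite subnK // dimvS ?capvSl. Qed.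

Lemma rel_rank_cons W h s : rel_rank W (h :: s) =
  (rel_rank W s + ~~ (W :&: common_ker s <= lker h.1)%VS)%N.
Proof.
have := rel_rankE W s; have := rel_rankE W (h :: s).
have := dim_cap_lker (W :&: common_ker s) h.1.
rewrite common_ker_cons (capvC (lker _)) capvA; lia.
Qed.

Lemma rel_rank_size W s : (rel_rank W s <= size s)%N.
Proof.
elim: s => [|h s IH] /=; last first.
  by rewrite rel_rank_cons -addn1 leq_add // leq_b1.
by rewrite /rel_rank /common_ker big_nil capvf subnn.
Qed.

(** The value 0 on the empty set removes the non-central subarrangements from the Whitney sum. *)
Definition dim_monomial X : {poly int} :=
  if X == set0 then 0 else 'X^(affine_dim X).

Lemma dim_monomial0 : dim_monomial set0 = 0.
Proof. by rewrite /dim_monomial eqxx. Qed.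

Lemma dim_monomialE X W : is_direction X W -> dim_monomial X = 'X^(\dim W).
Proof.
move=> dX; rewrite /dim_monomial (affine_dimE dX).
by case: eqP dX => // -> /is_direction_nonempty [].
Qed.

Lemma whitney_set0 s :
  whitney dim_monomial set0 [seq hyperplane h | h <- s] = 0.
Proof.
by elim: s => [|h s IH] /=; rewrite ?dim_monomial0 // set0I IH subrr.
Qed.

(** The vector [w] stays in the direction of every nonempty intersection of [X] with members of [s],
    so [h] cuts each of them in exactly one dimension less. *)
Lemma whitney_coloop s h X W w : is_direction X W ->
  w \in (W :&: common_ker s)%VS -> h.1 w != 0 ->
  whitney dim_monomial X [seq hyperplane g | g <- s] =
  'X * whitney dim_monomial (X `&` hyperplane h) [seq hyperplane g | g <- s].
Proof.
elim: s X W => [|g s IH] X W dX; rewrite memv_cap => /andP[wW] /=.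
  move=> _ hw; have [y Xy hy] := hyperplane_meets dX wW hw.
  rewrite (dim_monomialE dX) (dim_monomialE (is_direction_capI dX Xy hy)).
  rewrite -exprS; congr ('X^_); rewrite -(dim_cap_lker W h.1) -addn1.
  congr addn.
  case: subvP => // /(_ w wW); by rewrite memv_ker (negPf hw).
rewrite common_ker_cons memv_cap => /andP[gw ws] hw.
have wWs : w \in (W :&: common_ker s)%VS by rewrite memv_cap wW.
rewrite (IH X W) // mulrBr; congr (_ - _); rewrite setIAC.
have [->|/set0P[x [Xx gx]]] := eqVneq (X `&` hyperplane g) set0.
  by rewrite set0I whitney_set0 mulr0.
apply: (IH _ _ (is_direction_capI dX Xx gx)) => //.
by rewrite !memv_cap wW gw.
Qed.

Lemma size_addMX (p1 p2 : {poly int}) n :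
  (size p1 <= n.+1)%N -> (size p2 <= n)%N -> (size (p1 + 'X * p2)%R <= n.+1)%N.
Proof.
move=> s1 s2; apply: leq_trans (size_polyD _ _) _; rewrite geq_max s1 /=.
by apply: leq_trans (size_polyMleq _ _) _; rewrite size_polyX.
Qed.

(** The polynomial [p] is a(x) for the restriction of [s] to [X]. A hyperplane containing [X] would
    make the sum vanish and break the lower bound at k = 0, hence the second hypothesis. *)
Lemma whitney_bounds s X W : is_direction X W ->
  (forall h, h \in s -> ~ X `<=` hyperplane h) ->
  exists p : {poly int},
  [/\ (size p <= (rel_rank W s).+1)%N,
      whitney dim_monomial X [seq hyperplane h | h <- s] = rev_alt p (\dim W) &
      forall (q : int) (k : nat), k%:Z <= q + (rel_rank W s)%:Z + 1 ->
        gbinom ((rel_rank W s)%:Z + q)%:~R k <= binom_conv p q k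
          <= gbinom ((size s)%:Z + q)%:~R k].
Proof.
elim: s X W => [|h s IH] X W dX loopless.
  exists 1; split; first by rewrite size_poly1.
    by rewrite /= rev_alt1 (dim_monomialE dX).
  move=> q k _.
  by rewrite binom_conv1 /rel_rank /common_ker big_nil capvf subnn add0r lexx.
have loopless_s g : g \in s -> ~ X `<=` hyperplane g.
  by move=> gs; apply: loopless; rewrite inE gs orbT.
have [p [sp Qp bp]] := IH X W dX loopless_s.
have rW := rel_rankE W s; have rs := rel_rank_size W s.
rewrite rel_rank_cons.
(* The linear part of [h] is independent of those of [s] on [W] exactly when some [w] killed by all
   of [s] is not killed by [h]. *)
case: (boolP (_ <= _)%VS) => [|/subvPn[w wWs hw]] /=; last first.
  rewrite memv_ker in hw.
  (* As [w] is nonzero, [\dim W] exceeds the rank; so it is some d + 1, and [p] is not truncated by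
     [rev_alt p d]. *)
  have : (0 < \dim (W :&: common_ker s))%N.
    rewrite lt0n dimv_eq0; apply: contraNneq hw => e.
    by move: wWs; rewrite e memv0 => /eqP ->; rewrite linear0.
  case dW: (\dim W) rW => [|d] rW K0; first by lia.
  have pd : (size p <= d.+1)%N by lia.
  have := whitney_coloop dX wWs hw; rewrite Qp dW rev_altS //.
  (* Cancelling ['X] identifies the restriction's sum as [rev_alt p d]. *)
  move/(mulfI (negbT (polyX_eq0 _))) => Qh.
  exists (p + 'X * p); split.
  - by rewrite addn1 size_addMX // leqW.
  - by rewrite /= -Qh -rev_altS // rev_altD rev_altX.
  - move=> q k kq; rewrite binom_conv_shift.
    rewrite (_ : _%:Z + q = (rel_rank W s)%:Z + (q + 1)); last by lia.
    rewrite (_ : (size s).+1%:Z + q = (size s)%:Z + (q + 1)); last by lia.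
    by apply: bp; lia.
move=> sub; rewrite addn0.
(* When the restriction contributes 0, the same [p] serves: the rank is unchanged and the upper
   bound only grows with the list. *)
have dead : whitney dim_monomial (X `&` hyperplane h)
    [seq hyperplane g | g <- s] = 0 -> exists p : {poly int},
  [/\ (size p <= (rel_rank W s).+1)%N,
      whitney dim_monomial X [seq hyperplane g | g <- h :: s] =
        rev_alt p (\dim W) &
      forall (q : int) (k : nat), k%:Z <= q + (rel_rank W s)%:Z + 1 ->
        gbinom ((rel_rank W s)%:Z + q)%:~R k <= binom_conv p q k
          <= gbinom ((size (h :: s))%:Z + q)%:~R k].
  move=> Q0; exists p; split; rewrite //= ?Q0 ?subr0 // => q k kq.
  have /andP[-> up] := bp q k kq; apply: le_trans up _.
  rewrite (_ : (size s).+1%:Z + q = (size s)%:Z + q + 1); last by lia.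
  by apply: gbinom_leS; lia.
have [Xh|/set0P[x [Xx hx]]] := eqVneq (X `&` hyperplane h) set0.
  by apply: dead; rewrite Xh whitney_set0.
have dXh := is_direction_capI dX Xx hx.
(* If some [g] contains the restricted subspace, the sum vanishes by [whitney_eq0]; otherwise the
   induction hypothesis applies to the restriction. *)
have [[g gs Xhg]|loopless_h] :=
    pselect (exists2 g, g \in s & X `&` hyperplane h `<=` hyperplane g).
  apply: dead; apply: (@whitney_eq0 _ _ _ _ _ (hyperplane g)).
    exact: map_f.
  by move=> Y YXh; rewrite setIidl //; apply: subset_trans Xhg.
have {}loopless_h g : g \in s -> ~ X `&` hyperplane h `<=` hyperplane g.
  by move=> gs Xhg; apply: loopless_h; exists g.
have [p2 [sp2 Qp2 bp2]] := IH _ _ dXh loopless_h.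
have Wh : ~~ (W <= lker h.1)%VS.
  apply/negP => /subvP Wh; apply: (loopless h); first exact: mem_head.
  move=> y /(is_directionP dX Xx) /Wh.
  by rewrite memv_ker linearB /= hx subr_eq0 => /eqP.
have := dim_cap_lker W h.1; rewrite Wh addn1 => dWh.
(* By [sub], cutting [W] with the kernel of [h] leaves the common kernel unchanged, while the
   dimension of [W] drops by one. *)
have rWh : (rel_rank (W :&: lker h.1) s).+1 = rel_rank W s.
  have := rel_rankE (W :&: lker h.1) s.
  rewrite -capvA (capvC (lker _)) capvA (capv_idPl sub); lia.
exists (p + 'X * p2); split.
- by rewrite size_addMX // -rWh.
- by rewrite /= Qp Qp2 -dWh rev_altD rev_altX.
move=> q [|k] kq.
  by rewrite binom_convD binom_convX0 addr0 /binom_conv big_ord1 !gbinom0;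
     have := bp q 0 kq; rewrite /binom_conv big_ord1 !gbinom0.
(* The index drops from k + 1 to k just as the rank drops by one, so the range condition is
   preserved. *)
have kq2 : k%:Z <= q + (rel_rank (W :&: lker h.1) s)%:Z + 1 by lia.
have /andP[lo2 up2] := bp2 q k kq2; have /andP[lo up] := bp q k.+1 kq.
rewrite binom_convD binom_convXS; apply/andP; split.
  (* The deletion alone reaches the lower bound; the restriction adds a nonnegative amount. *)
  apply: le_trans lo _; rewrite lerDl; apply: le_trans lo2.
  by apply: gbinom_ge0; lia.
rewrite (_ : _%:Z + q = (size s)%:Z + q + 1) /=; last by lia.
by rewrite [X in gbinom X _]intrD gbinomSS lerD.
Qed.

End AffineGeometry.

(** * The Möbius function and the characteristic polynomial as Whitney sums *)

Section CharacteristicPolynomial.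
Context {F : fieldType} {V : vectType F} (A : {fset set V}).
Implicit Types (X Y H : set V) (Z : semilattice A).

Definition is_intersection X : Prop :=
  exists2 B : {fset set V}, fsubset B A & X = flat_of B.

Lemma flatsP X : reflect (X <> set0 /\ is_intersection X) (X \in flats A).
Proof.
rewrite !inE /=; apply: (iffP andP) => [[/imfsetP[B /=]]|[X0 [B BA eX]]].
  by rewrite fpowersetE => BA -> /eqP ?; split => //; exists B.
split; last exact/eqP.
by apply/imfsetP; exists B => //=; rewrite fpowersetE.
Qed.

Lemma is_intersectionT : is_intersection setT.
Proof. by have /flatsP[] := setT_flat A. Qed.

Lemma is_intersection_capI X H :
  is_intersection X -> H \in A -> is_intersection (X `&` H).
Proof.
move=> [B BA ->] HA; exists (H |` B)%fset.
  by apply/fsubsetP => G; rewrite !inE => /orP[/eqP -> //|/(fsubsetP BA)].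
apply/seteqP; split => x.
  move=> [Bx Hx] G /=; rewrite !inE => /orP[/eqP -> //|]; exact: Bx.
move=> HBx; split; last by apply: HBx; rewrite /= !inE eqxx.
by move=> G GB; apply: HBx; rewrite /= !inE GB orbT.
Qed.

Lemma semilattice_leP (Y Z : semilattice A) :
  reflect (val Z `<=` val Y) (Y <= Z)%O.
Proof. exact: asboolP. Qed.

Lemma flat0_le Z : (flat0 A <= Z)%O.
Proof. exact/semilattice_leP. Qed.

(** At most one flat equals [X], and an intersection containing the nonempty [Z] is itself a
    flat. *)
Lemma sum_le_flat Z X : is_intersection X ->
  \sum_(Y : semilattice A | (Y <= Z)%O) (X == val Y)%:R =
  `[< val Z `<=` X >]%:R :> int.
Proof.
move=> iX; case: asboolP => ZX.
  have X0 : X <> set0.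
    have /flatsP[Z0 _] := valP Z.
    by move=> X0; apply: Z0; rewrite -subset0 -X0.
  have fX : X \in flats A by apply/flatsP.
  rewrite (bigD1 (FSetSub fX)) /=; last exact/semilattice_leP.
  rewrite eqxx big1 ?addr0 // => Y /andP[_ neq].
  by case: eqP => // e; case/eqP: neq; apply: val_inj.
rewrite big1 // => Y /semilattice_leP YZ.
by case: eqP => // eX; case: ZX; rewrite eX.
Qed.

(* Whitney's theorem: mu(0, Z) counts with sign the subarrangements whose
   intersection is Z. *)
Lemma mobius_whitney Z : (forall H, H \in A -> H <> setT) ->
  mobius (flat0 A) Z = whitney (fun X => (X == val Z)%:R) setT A.
Proof.
move=> AT; pose g (Y : semilattice A) : int :=
  whitney (fun X => (X == val Y)%:R) setT A.
(* The summed function tests whether an intersection contains [Y]. Intersecting with a hyperplane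
   through [Y] does not alter this, and one exists because [Y] is not the whole space. *)
have sum_g (Y : semilattice A) : Y != flat0 A ->
    \sum_(Y' | (Y' <= Y)%O) g Y' = 0.
  move=> Y0; rewrite whitney_sum.
  rewrite (@eq_whitney _ _ is_intersection _ (fun X => `[< val Y `<=` X >]%:R)).
  - have /flatsP[_ [B BA eY]] := valP Y.
    have [B0|/fset0Pn[H HB]] := eqVneq B fset0.
      case/eqP: Y0; apply: val_inj; rewrite eY B0.
      by apply/seteqP; split => // x _ H /=; rewrite inE.
    have YH : val Y `<=` H by rewrite eY => x; apply.
    apply: (@whitney_eq0 _ _ _ _ _ H); first exact: (fsubsetP BA).
    move=> X _; congr (_ %:R); congr nat_of_bool.
    apply/asboolP/asboolP => [|YX].
      by move/subset_trans; apply; apply: subIsetl.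
    by move=> x Yx; split; [apply: YX | apply: YH].
  - by move=> X H iX HA; apply: is_intersection_capI.
  - by move=> X; apply: sum_le_flat.
  - exact: is_intersectionT.
(* As no hyperplane is the whole space, only the empty subarrangement has intersection [setT]. *)
have g0 : g (flat0 A) = 1.
  rewrite /g whitney_id /= ?eqxx // => X H HA.
  case: eqP => // XH; case: (AT _ HA).
  by apply/seteqP; split => // x _; have [] : (X `&` H) x by rewrite XH.
(* Both functions satisfy the same recursion; the induction is on the number of flats below [Z]. *)
have [k] := ubnP #|[set z | (z <= Z)%O]%SET|.
elim: k Z => // k IH Z; rewrite ltnS => Zk; rewrite mobiusE -/(g Z).
case: eqP => [<- //|/eqP]; rewrite eq_sym => /[dup] Z0 /sum_g.
rewrite (bigD1 Z) //= => /eqP; rewrite addr_eq0 => /eqP ->; congr (- _).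
apply: eq_big => [Y|Y]; first by rewrite flat0_le /= lt_neqAle andbC.
move=> /andP[_ YZ]; apply: IH; apply: leq_trans Zk.
apply: proper_card; apply/properP; split.
  apply/fintype.subsetP => t; rewrite !finset.in_set => tY.
  by apply: le_trans tY (ltW YZ).
by exists Z; rewrite !finset.in_set // lt_geF.
Qed.

(** After exchanging the two sums, each intersection meets only its own flat, or none if it is
    empty. *)
Lemma char_poly_whitney : (forall H, H \in A -> H <> setT) ->
  char_poly_arr A = whitney dim_monomial setT A.
Proof.
move=> AT; rewrite /char_poly_arr.
under eq_bigr do rewrite mobius_whitney // whitney_scale.
rewrite whitney_sum; apply: (@eq_whitney _ _ is_intersection).
- by move=> X H iX HA; apply: is_intersection_capI.
- move=> X iX; rewrite /dim_monomial; case: eqP => X0.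
    rewrite big1 // => Z _; have /flatsP[Z0 _] := valP Z.
    by case: eqP => [XZ|]; [case: Z0; rewrite -XZ | rewrite scale0r].
  have fX : X \in flats A by apply/flatsP.
  rewrite (bigD1 (FSetSub fX)) //= eqxx scale1r big1 ?addr0 // => Y neq.
  case: eqP => [e|]; last by rewrite scale0r.
  by case/eqP: neq; apply: val_inj.
- exact: is_intersectionT.
Qed.

End CharacteristicPolynomial.

(** * The rank of the intersection semilattice as the rank of the linear parts *)

Section Rank.
Context {F : fieldType} {V : vectType F} (A : {fset set V}).
Context (s : seq ('Hom(V, F^o) * F)).
Context (sA : [seq hyperplane h | h <- s] = A :> seq (set V)).

Lemma flat_direction (Z : semilattice A) :
  exists2 W : {vspace V}, is_direction (val Z) W & (common_ker s <= W)%VS.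
Proof.
have /flatsP[/eqP/set0P[x Zx] [B BA eZ]] := valP Z.
(* Taking all equations that hold on [Z], not only those from [B], gives the same direction and
   avoids matching [B] with a sublist of [s]. *)
exists (\bigcap_(h <- s | `[< val Z `<=` hyperplane h >]) lker h.1)%VS.
  apply: (@is_directionI _ _ _ _ x) => y; split.
    move=> Zy; apply/memv_bigcap_lker => h hs /asboolP Zh.
    by rewrite linearB /= (Zh _ Zx) (Zh _ Zy) subrr.
  move/memv_bigcap_lker => yx; rewrite eZ => H /= HB.
  have : H \in [seq hyperplane h | h <- s] by rewrite sA; apply: (fsubsetP BA).
  move=> /mapP[h hs eH].
  have Zh : val Z `<=` hyperplane h by rewrite -eH eZ => z; apply.
  have := yx h hs (asboolT Zh); rewrite linearB /= (Zh _ Zx) => /eqP.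
  by rewrite subr_eq0 eH => /eqP.
apply/subvP => u /memv_bigcap_lker us; apply/memv_bigcap_lker => h hs _.
exact: us.
Qed.

Lemma semilattice_dim_lt (Y Z : semilattice A) :
  (Y < Z)%O -> (affine_dim (val Z) < affine_dim (val Y))%N.
Proof.
rewrite lt_neqAle => /andP[neq /semilattice_leP ZY].
have [W dY _] := flat_direction Y; have [U dZ _] := flat_direction Z.
by apply: affine_dim_lt dY dZ ZY _ => e; case/eqP: neq; apply: val_inj.
Qed.

(** Dimension is injective on a chain and takes values between those of the common kernel and of the
    whole space. *)
Lemma card_chain (C : {set semilattice A}) :
  is_chain C -> (#|C| <= (rel_rank fullv s).+1)%N.
Proof.
move=> /forall_inP chC; have rV := rel_rankE (fullv : {vspace V}) s.
have dimP (Z : semilattice A) :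
    (\dim (fullv :&: common_ker s)%VS <= affine_dim (val Z)
      <= \dim (fullv : {vspace V}))%N.
  have [W dW KW] := flat_direction Z.
  by rewrite (affine_dimE dW) !dimvS ?subvf // capvC capvf.
pose f (Z : semilattice A) : 'I_(rel_rank fullv s).+1 :=
  inord (affine_dim (val Z) - \dim (fullv :&: common_ker s)%VS).
rewrite -(card_ord (rel_rank _ _).+1) -(@card_in_imset _ _ f) ?max_card //.
move=> Y Z YC ZC /(congr1 (@nat_of_ord _)).
have dY := dimP Y; have dZ := dimP Z; rewrite /f !inordK; try by lia.
move=> e; apply/eqP; apply/negPn/negP => neq.
have /forall_inP/(_ _ ZC) := chC _ YC.
have eYZ : affine_dim (val Y) = affine_dim (val Z).
  move: dY dZ e => /andP[dY _] /andP[dZ _] /(congr1 (addn^~ _)).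
  by move/(_ (\dim (fullv :&: common_ker s)%VS)); rewrite !subnK.
by move=> /orP[]; rewrite le_eqVlt ?(negPf neq) 1?eq_sym ?(negPf neq) /=;
   move=> /semilattice_dim_lt; rewrite eYZ ltnn.
Qed.

(** A chain is extended by cutting its top flat with a hyperplane that meets it properly; tracking
    the dimension of the top shows that one exists until the rank is reached. *)
Lemma exists_chain j : (j <= rel_rank fullv s)%N ->
  exists (C : {set semilattice A}) (Z : semilattice A),
  [/\ is_chain C, forall Y, Y \in C -> (Y <= Z)%O, #|C| = j.+1 &
      (affine_dim (val Z) + j)%N = \dim (fullv : {vspace V})].
Proof.
elim: j => [_|j IH jr].
  exists [set flat0 A]%SET, (flat0 A); split => [|Y||].
  - apply/forall_inP => Y /set1P ->; apply/forall_inP => Z /set1P ->.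
    exact: comparablexx.
  - by move/set1P ->.
  - by rewrite cards1.
  - by rewrite addn0 (affine_dimE is_directionT).
have [C [Z [/forall_inP chC CZ cC dZ]]] := IH (ltnW jr).
have [W dW KW] := flat_direction Z; have rV := rel_rankE (fullv : {vspace V}) s.
rewrite (affine_dimE dW) in dZ.
(* Otherwise [W] would lie in the common kernel, whose dimension is too small because j is below the
   rank. *)
have [h [hs [w [wW hw]]]] :
    exists h, h \in s /\ exists w, w \in W /\ h.1 w != 0.
  apply: contrapT => no; suff /dimvS : (W <= fullv :&: common_ker s)%VS by lia.
  rewrite subv_cap subvf; apply/subvP => w wW.
  apply/memv_bigcap_lker => h hs _; apply/eqP; apply: contrapT => /negP hw.
  by apply: no; exists h; split => //; exists w.
have [x Zx hx] := hyperplane_meets dW wW hw.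
have dZh := is_direction_capI dW Zx hx.
have fZh : val Z `&` hyperplane h \in flats A.
  apply/flatsP; split; first by move/eqP; apply/negP/set0P; exists x.
  apply: is_intersection_capI; first by have /flatsP[] := valP Z.
  by have := map_f hyperplane hs; rewrite sA.
have ZZh : (Z <= FSetSub fZh :> semilattice A)%O.
  by apply/semilattice_leP => /=; apply: subIsetl.
have dWh := dim_cap_lker W h.1.
have Wh : ~~ (W <= lker h.1)%VS.
  by apply/subvPn; exists w => //; rewrite memv_ker.
exists (FSetSub fZh |: C)%SET, (FSetSub fZh); split.
- apply/forall_inP => Y /setU1P YC; apply/forall_inP => Y' /setU1P YC'.
  case: YC YC' => [->|YC] [->|YC'].
  + exact: comparablexx.
  + by rewrite comparable_sym le_comparable // (le_trans (CZ _ YC')).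
  + by rewrite le_comparable // (le_trans (CZ _ YC)).
  + by have /forall_inP := chC _ YC; apply.
- by move=> Y /setU1P[-> //|/CZ /le_trans]; apply.
- rewrite cardsU1 cC; case: (boolP (_ \in C)) => // /CZ /semilattice_leP /= ZZ.
  have := dimvS (is_direction_sub dZh dW ZZ).
  by rewrite -dWh Wh addn1 ltnn.
- by rewrite /= (affine_dimE dZh) -dZ -dWh Wh addn1 addSnnS.
Qed.

Lemma arr_rankE : arr_rank A = rel_rank fullv s.
Proof.
apply/eqP; rewrite eqn_leq; apply/andP; split.
  apply/bigmax_leqP => Z _; apply/bigmax_leqP => C /andP[chC _].
  by have := card_chain chC; case: #|C|.
have [C [Z [chC CZ cC _]]] := exists_chain (leqnn _).
apply: leq_trans (leq_bigmax Z).
rewrite -[rel_rank _ _]/(_.+1.-1) -cC.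
apply: (@leq_bigmax_cond _ _ (fun C : {set semilattice A} => #|C|.-1)).
by rewrite chC; apply/forall_inP => Y /CZ.
Qed.

End Rank.

(** * Equations for an arrangement, and the coefficient bounds *)

Lemma arrangement_hyperplanes (F : fieldType) (V : vectType F)
    (L : seq (set V)) : (forall H, H \in L -> is_hyperplane H) ->
  exists2 s : seq ('Hom(V, F^o) * F), [seq hyperplane h | h <- s] = L &
    forall h, h \in s -> h.1 != 0.
Proof.
elim: L => [|H L IH] hL; first by exists [::].
have [s sL s0] : exists2 s : seq ('Hom(V, F^o) * F),
    [seq hyperplane h | h <- s] = L & forall h, h \in s -> h.1 != 0.
  by apply: IH => G GL; apply: hL; rewrite inE GL orbT.
have [f [c [f0 eH]]] := hL H (mem_head _ _).
exists ((f, c) :: s); first by rewrite /= sL eH.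
by move=> h; rewrite inE => /orP[/eqP ->|/s0].
Qed.

Lemma hyperplane_proper (F : fieldType) (V : vectType F)
    (h : 'Hom(V, F^o) * F) : h.1 != 0 -> ~ setT `<=` hyperplane h.
Proof.
move=> h0 Th; case/eqP: h0; apply/lfunP => v; rewrite zero_lfunE.
by rewrite (Th v I) -(Th 0 I) linear0.
Qed.

Theorem theorem2p3 (F : fieldType) (V : vectType F) (A : {fset set V})
    (n m r : nat) (a : nat -> int) :
  is_arrangement A ->
  \dim {:V} = n ->
  #|` A|%fset = m ->
  arr_rank A = r ->
  (forall i : nat, a i = char_coef A i) ->
  char_poly_arr A = \sum_(i < r.+1) ((-1) ^+ i * a i) *: 'X^(n - i) /\
  (forall (q : int) (k : nat), (k%:Z <= q + r%:Z + 1) ->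
    (gbinom (r%:Z + q)%:~R k : rat)
      <= \sum_(i < k.+1) gbinom q%:~R (k - i) * (a i)%:~R /\
    \sum_(i < k.+1) gbinom q%:~R (k - i) * (a i)%:~R
      <= (gbinom (m%:Z + q)%:~R k : rat)).
Proof.
move=> arrA dimV cA rA aA.
have [s sA s0] := arrangement_hyperplanes arrA.
have proper_s h : h \in s -> ~ [set: V] `<=` hyperplane h.
  by move=> /s0; apply: hyperplane_proper.
have AT H : H \in A -> H <> setT.
  have -> : (H \in A) = (H \in [seq hyperplane h | h <- s]) by rewrite sA.
  by move=> /mapP[h hs ->] e; apply: (proper_s h hs); rewrite e.
have := arr_rankE sA; rewrite rA => er.
have [p []] := whitney_bounds is_directionT proper_s.
rewrite -er sA -char_poly_whitney // dimV => sp chi bounds.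
have rn : (r <= n)%N by rewrite er -dimV -(rel_rankE fullv s) leq_addr.
(* Beyond r both sides are 0: the left by convention, the right by the size of [p]. *)
have ap i : a i = p`_i.
  rewrite aA /char_coef rA dimV; case: leqP => ir; last first.
    by rewrite nth_default // (leq_trans sp).
  by rewrite chi coef_rev_alt // (leq_trans ir).
have sm : size s = m by rewrite -cA -sA size_map.
split; first by rewrite chi (rev_alt_trunc rn sp); under eq_bigr do rewrite -ap.
move=> q k kq; have := bounds q k kq; rewrite sm /binom_conv.
by under eq_bigr do rewrite -ap; move=> /andP.
Qed.
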